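(* Let $g$ be a piecewise $D$-finite function on $[a,b]$ with jump points $\xi_1<\dots<\xi_K$ in $(a,b)$ ($K\ge0$) and pieces $g_0,\dots,g_K$, every piece annihilated by the same operator $\mathfrak{D}$ of order $N$. Let $\{u_i\}_{i=1}^N$ be a basis of the solution space $\{f:\mathfrak{D}f\equiv0\}$, and write $g_n(x)=\sum_{i=1}^N\alpha_{i,n}u_i(x)$ on $[\xi_n,\xi_{n+1}]$ for $0\le n\le K$. Let $c^n_{i,k}=\int_{\xi_n}^{\xi_{n+1}}x^ku_i(x)\,dx$ for $0\le n\le K$, and $m_k=\int_a^bx^kg(x)\,dx$. Then for every $\widetilde M\in\mathbb{N}$, $$\begin{pmatrix}c^0_{1,0}&\dots&c^0_{N,0}&\dots&c^K_{N,0}\\ \vdots&&\vdots&&\vdots\\ c^0_{1,\widetilde M}&\dots&c^0_{N,\widetilde M}&\dots&c^K_{N,\widetilde M}\end{pmatrix}\begin{pmatrix}\alpha_{1,0}\\ \vdots\\ \alpha_{N,0}\\ \vdots\\ \alpha_{N,K}\end{pmatrix}=\begin{pmatrix}m_0\\ m_1\\ \vdots\\ m_{\widetilde M}\end{pmatrix},$$ where the columns of the matrix are indexed by the pairs $(i,n)$, $1\le i\le N$, $0\le n\le K$, in the order $(1,0),\dots,(N,0),(1,1),\dots,(N,1),\dots,(N,K)$, the same order as the entries $\alpha_{i,n}$ of the vector.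
   Context: $-\infty<a=\xi_0<\xi_1<\dots<\xi_{K+1}=b<\infty$. $\mathfrak{D}=\sum_{j=0}^Np_j(x)\frac{d^j}{dx^j}$, $N\ge1$, has real polynomial coefficients with $p_N(x)\neq0$ for all $x\in[a,b]$, so the space of solutions of $\mathfrak{D}f=0$ on $[a,b]$ has dimension $N$. The function $g:[a,b]\to\mathbb{R}$ equals $g_n$ on $[\xi_n,\xi_{n+1}]$ (values at jump points being irrelevant), with $\mathfrak{D}g_n\equiv0$ there. *)

(* Defs.v *)
From mathcomp Require Export all_boot all_order all_algebra.
From mathcomp Require Export all_classical all_reals all_analysis.
Export Order.TTheory GRing.Theory Num.Theory.
Export numFieldNormedType.Exports.

Set Implicit Arguments.
Unset Strict Implicit.
Unset Printing Implicit Defensive.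

Local Open Scope classical_set_scope.
Local Open Scope ring_scope.

(* Derivative relative to a set A: the difference quotient only uses points of
   A, so on a segment the derivative at an endpoint is one-sided and the values
   of f outside the segment play no role. *)
Definition diff_quot {R : realType} (f : R -> R) (x : R) : R -> R :=
  fun y => (f y - f x) / (y - x).

Definition derivable_within {R : realType} (A : set R) (f : R -> R) (x : R) :=
  cvg (diff_quot f x @ within A x^').

Definition derive_within {R : realType} (A : set R) (f : R -> R) (x : R) : R :=
  lim (diff_quot f x @ within A x^').

Definition derive_withinn {R : realType} (A : set R) (j : nat) (f : R -> R) :
    R -> R :=
  iter j (derive_within A) f.

Definition diff_op {R : realType} (N : nat) (p : 'I_N.+1 -> {poly R})
    (A : set R) (f : R -> R) (x : R) : R :=
  \sum_(j < N.+1) (p j).[x] * derive_withinn A j f x.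

Definition is_solution {R : realType} (N : nat) (p : 'I_N.+1 -> {poly R})
    (A : set R) (f : R -> R) : Prop :=
  (forall j : nat, (j < N)%N ->
     forall x, A x -> derivable_within A (derive_withinn A j f) x) /\
  (forall x, A x -> diff_op p A f x = 0).

(* Functions on A are represented by total functions, so linear relations
   between them are only required to hold at the points of A. *)
Definition is_solution_basis {R : realType} (N : nat) (p : 'I_N.+1 -> {poly R})
    (A : set R) (u : 'I_N -> R -> R) : Prop :=
  [/\ forall i, is_solution p A (u i),
      forall c : 'I_N -> R,
        (forall x, A x -> \sum_(i < N) c i * u i x = 0) -> forall i, c i = 0
    & forall f : R -> R, is_solution p A f ->
        exists c : 'I_N -> R, forall x, A x -> f x = \sum_(i < N) c i * u i x].

(* The points are xi 0 = a, ..., xi K.+1 = b, the jump points being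
   xi 1, ..., xi K; the values xi n for n > K.+1 are irrelevant. *)
Definition is_subdivision {R : realType} (a b : R) (K : nat) (xi : nat -> R) :
    Prop :=
  [/\ xi 0%N = a, xi K.+1 = b &
      forall n : nat, (n <= K)%N -> xi n < xi n.+1].

Definition piecewise_Dfinite {R : realType} (N : nat)
    (p : 'I_N.+1 -> {poly R}) (K : nat) (xi : nat -> R)
    (gp : 'I_K.+1 -> R -> R) (g : R -> R) : Prop :=
  (forall n : 'I_K.+1, is_solution p `[xi n, xi n.+1] (gp n)) /\
  (forall (n : 'I_K.+1) (x : R), x \in `[xi n, xi n.+1] ->
     (forall l : nat, (1 <= l <= K)%N -> x != xi l) -> g x = gp n x).

Definition moment {R : realType} (a b : R) (f : R -> R) (k : nat) : R :=
  \int[lebesgue_measure]_(x in `[a, b]) (x ^+ k * f x).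

(* Concatenating the blocks n = 0, ..., K orders the pairs (i, n) as
   (1,0), ..., (N,0), (1,1), ..., (N,K). *)
Definition moment_mx {R : realType} (N K M : nat) (xi : nat -> R)
    (u : 'I_N -> R -> R) : 'M[R]_(M.+1, \sum_(n < K.+1) N) :=
  \mxrow_(n < K.+1)
    \matrix_(k < M.+1, i < N) moment (xi n) (xi n.+1) (u i) k.

Definition coef_col {R : realType} (N K : nat) (alpha : 'I_N -> 'I_K.+1 -> R) :
    'cV[R]_(\sum_(n < K.+1) N) :=
  \mxcol_(n < K.+1) \col_(i < N) alpha i n.

(* Main.v *)
(* The basis functions are differentiable on the segment [a, b], hence
   continuous there, so all the integrals involved converge.  On the open
   interval between consecutive xi n the function g coincides with the linear
   combination of the u i given by alpha, and the finitely many remaining points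
   are negligible, so row k of the identity is the additivity of the integral
   of x ^+ k * g x over the subdivision. *)
Require Import Defs.
From mathcomp Require Import all_boot all_order all_algebra.
From mathcomp Require Import all_classical all_reals all_analysis.
From mathcomp Require Import measurable_realfun.

Local Open Scope classical_set_scope.
Local Open Scope ring_scope.

(** For [y != x], [f y] equals [diff_quot f x y * (y - x) + f x], whose first term is a convergent
    factor times one tending to 0. *)
Lemma derivable_within_continuous {R : realType} (A : set R) (f : R -> R) :
  (forall x, A x -> derivable_within A f x) -> {within A, continuous f}.
Proof.
move=> df; apply/subspace_continuousP => x Ax.
have Fx : Filter (within A x^') by exact: within_filter.
have idx : id @ within A x^' --> x.
  by move=> P /nbhs_dnbhs; apply: filterS => y Py _.
have fx : f @ within A x^' --> f x.
  have dqx : (fun y => diff_quot f x y * (y - x) + f x) @ within A x^' --> f x.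
    rewrite -[X in _ --> X]add0r -[X in X + _](mulr0 (derive_within A f x)).
    rewrite -[X in _ * X](subrr x).
    apply: cvgD; last exact: cvg_cst.
    by apply: cvgM; [exact: df|apply: cvgB => //; exact: cvg_cst].
  apply: cvg_trans dqx; apply: (@near_eq_cvg _ _ _ Fx).
  rewrite near_withinE; near=> y => _.
  rewrite /diff_quot divfK ?subrK// subr_eq0.
  by near: y; exact: nbhs_dnbhs_neq.
(* From the punctured to the full neighbourhood: the missing case [y = x] holds because [P] is a
   neighbourhood of [f x], hence contains it. *)
move=> P /[dup] /nbhs_singleton Pfx /fx xP.
have {}xP : \forall y \near x, y != x -> A y -> P (f y) by exact: xP.
apply: filterS xP => y Py Ay.
by have [->//|yx] := eqVneq y x; exact: Py.
Unshelve. all: by end_near. Qed.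

(** The sets may overlap, so the integral of the absolute value is split over [A] and [B \ A]; the
    second part is at most the integral over [B]. *)
Lemma integrable_setU {d} {T : measurableType d} {R : realType}
    (mu : {measure set T -> \bar R}) (A B : set T) (f : T -> \bar R) :
  measurable A -> measurable B ->
  mu.-integrable A f -> mu.-integrable B f -> mu.-integrable (A `|` B) f.
Proof.
move=> mA mB /integrableP[mfA fA] /integrableP[mfB fB].
have mBA : measurable (B `\` A) by exact: measurableD.
have ABE : A `|` B = A `|` (B `\` A).
  by rewrite -[LHS](setDUK (@subsetUl _ A B)) setDUl setDv set0U.
have mfAB : measurable_fun (A `|` B) f by exact/measurable_funU.
apply/integrableP; split => //.
rewrite ABE ge0_integral_setU//; last 2 first.
- by rewrite -ABE; exact: measurableT_comp.
- by apply/disj_setPS => x [Ax []].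
apply: lte_add_pinfty => //; apply: le_lt_trans fB.
by apply: ge0_subset_integral => //; exact: measurableT_comp.
Qed.

Lemma integrable_itvoo_cc {R : realType} (x y : R) (f : R -> R) :
  lebesgue_measure.-integrable `]x, y[ (EFin \o f) ->
  lebesgue_measure.-integrable `[x, y] (EFin \o f).
Proof.
move=> /integrableP[mf fi]; apply/integrableP; split.
  exact: emeasurable_fun_itv_cc mf.
rewrite integral_itv_bndoo//.
exact: measurableT_comp.
Qed.

Lemma integrable_exprM {R : realType} (x y : R) (f : R -> R) (k : nat) :
  {within `[x, y], continuous f} ->
  lebesgue_measure.-integrable `[x, y] (EFin \o (fun t => t ^+ k * f t)).
Proof.
move=> cf; apply: continuous_compact_integrable; first exact: segment_compact.
have ck : {within `[x, y], continuous (fun t : R => t ^+ k)}.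
  by apply: continuous_subspaceT => t; exact: exprn_continuous.
by move=> t; apply: cvgM; [exact: ck|exact: cf].
Qed.

Lemma integrable_lin_comb {d} {T : measurableType d} {R : realType}
    (mu : {measure set T -> \bar R}) (D : set T) (I : Type) (s : seq I)
    (c : I -> R) (f : I -> T -> R) :
  measurable D -> (forall i, mu.-integrable D (EFin \o f i)) ->
  mu.-integrable D (EFin \o (fun x => \sum_(i <- s) c i * f i x)).
Proof.
move=> mD fi.
have cfi i : true -> mu.-integrable D (fun x => ((c i)%:E * (f i x)%:E)%E).
  by move=> _; exact: integrableZl (fi i).
have := integrable_sum mD s cfi.
by apply: eq_integrable => // x _ /=; rewrite -sumEFin.
Qed.

(** The endpoints form a null set. This is what yields measurability and integrability for a
    function whose values at the jump points are arbitrary. *)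
Lemma eq_integrable_itv {R : realType} (x y : R) (f g : R -> R) :
  {in `]x, y[, f =1 g} ->
  lebesgue_measure.-integrable `[x, y] (EFin \o f) ->
  lebesgue_measure.-integrable `[x, y] (EFin \o g).
Proof.
move=> fg fi; apply: integrable_itvoo_cc.
have : lebesgue_measure.-integrable `]x, y[ (EFin \o f).
  by apply: integrableS fi => //; exact: subset_itv_oo_cc.
by apply: eq_integrable => // t; rewrite inE => /fg /= ->.
Qed.

Lemma eq_Rintegral_itv {R : realType} (x y : R) (f g : R -> R) :
  {in `]x, y[, f =1 g} ->
  lebesgue_measure.-integrable `[x, y] (EFin \o f) ->
  \int[lebesgue_measure]_(t in `[x, y]) f t =
  \int[lebesgue_measure]_(t in `[x, y]) g t.
Proof.
move=> fg fi; have gi := eq_integrable_itv _ _ _ _ fg fi.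
have oo_sub : `]x, y[ `<=` `[x, y] by exact: subset_itv_oo_cc.
congr fine; rewrite [LHS]integral_itv_bndoo; last first.
  by apply: (measurable_int lebesgue_measure); exact: integrableS fi.
rewrite [RHS]integral_itv_bndoo; last first.
  by apply: (measurable_int lebesgue_measure); exact: integrableS gi.
by apply: eq_integral => t; rewrite inE => /fg ->.
Qed.

Lemma Rintegral_lin_comb {d} {T : measurableType d} {R : realType}
    (mu : {measure set T -> \bar R}) (D : set T) (I : Type) (s : seq I)
    (c : I -> R) (f : I -> T -> R) :
  measurable D -> (forall i, mu.-integrable D (EFin \o f i)) ->
  \int[mu]_(x in D) (\sum_(i <- s) c i * f i x) =
  \sum_(i <- s) c i * \int[mu]_(x in D) f i x.
Proof.
move=> mD fi; elim: s => [|i s IHs].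
  rewrite big_nil; under eq_Rintegral do rewrite big_nil.
  by rewrite /Rintegral integral0_eq.
rewrite big_cons -IHs -RintegralZl//; under eq_Rintegral do rewrite big_cons.
apply: RintegralD => //; last exact: integrable_lin_comb.
have := integrableZl mD (c i) (fi i).
by apply: eq_integrable => // x _ /=; rewrite EFinM.
Qed.

Lemma Rintegral_itv_subdivision {R : realType} (xi : nat -> R) (f : R -> R)
    (n : nat) :
  (forall i, (i < n)%N -> xi i <= xi i.+1) ->
  (forall i, (i < n)%N ->
     lebesgue_measure.-integrable `[xi i, xi i.+1] (EFin \o f)) ->
  \int[lebesgue_measure]_(x in `[xi 0, xi n]) f x =
  \sum_(i < n) \int[lebesgue_measure]_(x in `[xi i, xi i.+1]) f x.
Proof.
move=> le_xi fi.
(* The induction also carries the ordering and the integrability on the whole interval, both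
   required to cut it at [xi n]. *)
suff: xi 0%N <= xi n /\
    (lebesgue_measure.-integrable `[xi 0, xi n] (EFin \o f) /\
    \int[lebesgue_measure]_(x in `[xi 0, xi n]) f x =
    \sum_(i < n) \int[lebesgue_measure]_(x in `[xi i, xi i.+1]) f x).
  by case=> _ [].
elim: n => [|n IHn] in le_xi fi *.
  rewrite big_ord0 set_itv1 Rintegral_set1; split=> //; split=> //.
  apply/integrableP; split; first exact: measurable_fun_set1.
  by rewrite integral_set1.
have [||le0n [i0n E]] := IHn.
- by move=> i /ltnW; exact: le_xi.
- by move=> i /ltnW; exact: fi.
have len := le_xi n (ltnSn n); have fin := fi n (ltnSn n).
have splitE : `[xi 0%N, xi n.+1]%classic =
    (`[xi 0%N, xi n] `|` `]xi n, xi n.+1])%classic.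
  by rewrite -itv_bndbnd_setU ?bnd_simp.
have fin' : lebesgue_measure.-integrable `]xi n, xi n.+1] (EFin \o f).
  by apply: integrableS fin => //; exact: subset_itv_oc_cc.
have i0n1 : lebesgue_measure.-integrable `[xi 0%N, xi n.+1] (EFin \o f).
  by rewrite splitE; exact: integrable_setU.
split; [exact: le_trans len|split=> //].
(* Dropping the left endpoint [xi n] turns the last integral into a difference of two integrals
   starting at [xi 0]. *)
rewrite big_ord_recr /= -E -[X in _ + X]Rintegral_itv_obnd_cbnd//.
rewrite -(@Rintegral_itvB _ f (BLeft (xi 0%N)) (BRight (xi n.+1)) (xi n))//.
by rewrite addrC subrK.
Qed.

Theorem proposition3p3 (R : realType) (a b : R) (N K : nat)
    (p : 'I_N.+1 -> {poly R}) (xi : nat -> R)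
    (gp : 'I_K.+1 -> R -> R) (g : R -> R)
    (u : 'I_N -> R -> R) (alpha : 'I_N -> 'I_K.+1 -> R)
    (N_ge1 : (1 <= N)%N)
    (xiP : is_subdivision a b K xi)
    (pN_neq0 : forall x : R, x \in `[a, b] -> (p ord_max).[x] != 0)
    (gP : piecewise_Dfinite p xi gp g)
    (uP : is_solution_basis p `[a, b] u)
    (alphaP : forall (n : 'I_K.+1) (x : R), x \in `[xi n, xi n.+1] ->
       gp n x = \sum_(i < N) alpha i n * u i x) :
  forall M : nat,
    moment_mx K M xi u *m coef_col alpha = \col_(k < M.+1) moment a b g k.
Proof.
move=> M.
have [xi0 xiK ltxi] := xiP; have [_ gE] := gP; have [u_sol _ _] := uP.
have le_xi i j : (i <= j <= K.+1)%N -> xi i <= xi j.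
  move=> /andP[ij jK]; elim: j => [|j IHj] in ij jK *.
    by move: ij; rewrite leqn0 => /eqP ->.
  move: ij; rewrite leq_eqVlt => /predU1P[->//|ij].
  by apply: le_trans (IHj ij (ltnW jK)) (ltW _); exact: ltxi.
have u_cont i (n : 'I_K.+1) : {within `[xi n, xi n.+1], continuous (u i)}.
  apply: (@continuous_subspaceW _ _ _ `[a, b]%classic).
    apply: subset_itv; rewrite bnd_simp -?xi0 -?xiK le_xi//=.
    - by rewrite ltnW.
    - by rewrite leqnn andbT ltn_ord.
  apply: derivable_within_continuous => x abx.
  (* Since [N >= 1], the differentiability clause of [is_solution] covers order 0, that is, [u i]
     itself. *)
  exact: (u_sol i).1 N_ge1 x abx.
have u_int i (n : 'I_K.+1) k := @integrable_exprM _ _ _ _ k (u_cont i n).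
have piece_int (n : 'I_K.+1) k : lebesgue_measure.-integrable
    `[xi n, xi n.+1] (EFin \o (fun x => \sum_(i < N) alpha i n * (x ^+ k * u i x))).
  by apply: integrable_lin_comb.
have piece_eq (n : 'I_K.+1) k : {in `]xi n, xi n.+1[,
    (fun x => \sum_(i < N) alpha i n * (x ^+ k * u i x)) =1
    (fun x => x ^+ k * g x)}.
  move=> x x_in.
  have x_cc : x \in `[xi n, xi n.+1] by exact: subset_itv_oo_cc x_in.
  rewrite (gE n) ?alphaP// => [|l /andP[_ lK]].
    by rewrite mulr_sumr; apply: eq_bigr => i _; rewrite mulrCA.
  move: x_in; rewrite in_itv/= => /andP[ltx xlt].
  (* No jump point is interior to the piece: [xi l] is at most [xi n] if [l <= n], and at least
     [xi n.+1] otherwise. *)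
  have [ln|nl] := leqP l n.
    rewrite gt_eqF//; apply: le_lt_trans ltx; apply: le_xi.
    by rewrite ln ltnW.
  rewrite lt_eqF//; apply: lt_le_trans xlt _; apply: le_xi.
  by rewrite nl leqW.
(* The block row times the block column is a sum over [n] of block products, matching the
   subdivision of the integral piece by piece. *)
rewrite /moment_mx /coef_col mul_mxrow_mxcol; apply/matrixP => k j.
rewrite summxE !mxE /moment -xi0 -xiK Rintegral_itv_subdivision; last 2 first.
- by move=> i iK; rewrite ltW// ltxi.
(* Integrability of [x ^+ k * g x] is transferred from the combination of the [u i], the two
   agreeing inside the piece. *)
- move=> i iK; exact: eq_integrable_itv _ _ _ _ (piece_eq (Ordinal iK) k) _.
apply: eq_bigr => n _; rewrite mxE -(eq_Rintegral_itv _ _ _ _ (piece_eq n k))//.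
rewrite Rintegral_lin_comb//.
by apply: eq_bigr => i _; rewrite !mxE mulrC.
Qed.
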